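(* Let $f:R_{1}\rightarrow R_{2}$ be a ring homomorphism, $J$ an ideal of $R_{2}$, $M_{1}$ an $R_{1}$-module, $M_{2}$ an $R_{2}$-module (considered as an $R_{1}$-module via $f$), and $\varphi:M_{1}\rightarrow M_{2}$ an $R_{1}$-module homomorphism. Let $M_{1}\bowtie^{\varphi}JM_{2}=\{(x_{1},\varphi(x_{1})+x_{2})\mid x_{1}\in M_{1},\ x_{2}\in JM_{2}\}$, regarded as an $(R_{1}\bowtie^{f}J)$-module. Let $N_{1}$ be a proper submodule of $M_{1}$, and let $N_{1}\bowtie^{\varphi}JM_{2}=\{(x_{1},\varphi(x_{1})+x_{2})\mid x_{1}\in N_{1},\ x_{2}\in JM_{2}\}$. Then the following statements are equivalent: (1) $N_{1}\bowtie^{\varphi}JM_{2}$ is a gsdf-absorbing submodule of the $(R_{1}\bowtie^{f}J)$-module $M_{1}\bowtie^{\varphi}JM_{2}$. (2) $N_{1}$ is a gsdf-absorbing submodule of the $R_{1}$-module $M_{1}$.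
   Context: All rings are commutative with identity $1\neq 0$, ring homomorphisms preserve the identity, and all modules are unital. Let $R$ be a ring and $M$ an $R$-module. A proper submodule $N$ of $M$ is called a generalized square-difference factor absorbing submodule (gsdf-absorbing submodule) if for all $u,v\in R$ and $x\in M$, the condition $(u^{2}-v^{2})x\in N$ implies that $(u-v)x\in N$ or $(u+v)^{k}x\in N$ for some integer $k\geq 1$. For a ring homomorphism $f:R_{1}\to R_{2}$ and an ideal $J$ of $R_{2}$, the amalgamation of $R_{1}$ with $R_{2}$ along $J$ with respect to $f$ is the subring $R_{1}\bowtie^{f}J=\{(u,f(u)+j)\mid u\in R_{1},\ j\in J\}$ of $R_{1}\times R_{2}$. The $(R_{1}\bowtie^{f}J)$-module structure on $M_{1}\bowtie^{\varphi}JM_{2}$ (a subgroup of $M_{1}\times M_{2}$) is given by $(u,f(u)+j)\cdot(x_{1},\varphi(x_{1})+x_{2})=(ux_{1},\ \varphi(ux_{1})+f(u)x_{2}+j\varphi(x_{1})+jx_{2})$. *)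

(* Defs.v *)
From HB Require Import structures.
From mathcomp Require Import all_boot all_algebra.
From mathcomp Require Import boolp.

Set Implicit Arguments.
Unset Strict Implicit.
Unset Printing Implicit Defensive.

Import GRing.Theory.
Local Open Scope ring_scope.

Definition proper_submod (R : comNzRingType) (M : lmodType R) (N : {pred M}) :
  Prop := submod_closed N /\ exists x, x \notin N.

Definition gsdf_absorbing (R : comNzRingType) (M : lmodType R) (N : {pred M}) :
  Prop :=
  proper_submod N /\
  forall (u v : R) (x : M), (u ^+ 2 - v ^+ 2) *: x \in N ->
    (u - v) *: x \in N \/ exists k : nat, (1 <= k)%N /\ (u + v) ^+ k *: x \in N.

(* Ideals of a commutative ring R are the submodules of the regular module     *)
(* R^o; the structure idealr of ring_quotient is not used because it excludes  *)
(* the unit ideal. Set-theoretic predicates are made boolean by asbool.        *)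

Section IdealSmul.
Variables (R : comNzRingType) (J : submodClosed R^o) (M : lmodType R).

(* The submodule JM: finite sums of products j *: m with j in J. *)
Definition ideal_smul : {pred M} := fun y =>
  `[< exists s : seq (R * M),
        (forall p, p \in s -> p.1 \in J) /\ y = \sum_(p <- s) p.1 *: p.2 >].

Lemma ideal_smulP y :
  reflect (exists s : seq (R * M),
             (forall p, p \in s -> p.1 \in J) /\ y = \sum_(p <- s) p.1 *: p.2)
          (y \in ideal_smul).
Proof. exact: asboolP. Qed.

Fact ideal_smul_closed : submod_closed ideal_smul.
Proof.
split; first by apply/ideal_smulP; exists [::]; rewrite big_nil.
move=> a _ _ /ideal_smulP[s [sJ ->]] /ideal_smulP[t [tJ ->]].
apply/ideal_smulP; exists ([seq (a * p.1, p.2) | p <- s] ++ t); split.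
  move=> p; rewrite mem_cat => /orP[/mapP[q /sJ qJ ->] /=|/tJ //].
  exact: (rpredZ a qJ).
rewrite big_cat big_map scaler_sumr; congr (_ + _).
by apply: eq_bigr => p _; rewrite scalerA.
Qed.

HB.instance Definition _ :=
  GRing.isSubmodClosed.Build R M ideal_smul
    ideal_smul_closed.

Lemma mem_ideal_smul j m : j \in J -> j *: m \in ideal_smul.
Proof.
move=> jJ; apply/ideal_smulP; exists [:: (j, m)].
by rewrite big_seq1; split=> // p; rewrite inE => /eqP ->.
Qed.

End IdealSmul.

Arguments ideal_smul {R} J M.

Section AmalgRing.
Variables (R1 R2 : comNzRingType) (f : {rmorphism R1 -> R2}).
Variable J : submodClosed R2^o.

Definition amalg_ring_pred : {pred R1 * R2} := fun r =>
  `[< exists u j, j \in J /\ r = (u, f u + j) >].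

Lemma amalg_ringP r :
  reflect (exists u j, j \in J /\ r = (u, f u + j)) (r \in amalg_ring_pred).
Proof. exact: asboolP. Qed.

Fact amalg_ring_closed : subring_closed amalg_ring_pred.
Proof.
have JM a b : b \in J -> a * b \in J by exact: (@rpredZ _ _ J a b).
have JB a b : a \in J -> b \in J -> a - b \in J by
  exact: (GRing.submod_closedB (submodClosedP J)).2.
have JD a b : a \in J -> b \in J -> a + b \in J by exact: (@rpredD R2^o J a b).
split.
- by apply/amalg_ringP; exists 1, 0; rewrite rmorph1 addr0 (rpred0 J).
- move=> _ _ /amalg_ringP[u [j [jJ ->]]] /amalg_ringP[v [k [kJ ->]]].
  apply/amalg_ringP; exists (u - v), (j - k); split; first exact: (JB _ _ jJ kJ).
  by congr (_, _); rewrite rmorphB /= opprD addrACA.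
- move=> _ _ /amalg_ringP[u [j [jJ ->]]] /amalg_ringP[v [k [kJ ->]]].
  apply/amalg_ringP; exists (u * v), (f u * k + (f v + k) * j); split.
    exact: (JD _ _ (JM _ _ kJ) (JM _ _ jJ)).
  by congr (_, _); rewrite rmorphM /= mulrDl mulrDr addrA (mulrC j).
Qed.

HB.instance Definition _ :=
  GRing.isSubringClosed.Build (R1 * R2)%type amalg_ring_pred amalg_ring_closed.

Record amalg_ring :=
  AmalgRing { amalg_ring_val : R1 * R2; _ : amalg_ring_val \in amalg_ring_pred }.

HB.instance Definition _ := [isSub for amalg_ring_val].
HB.instance Definition _ := [Choice of amalg_ring by <:].
HB.instance Definition _ := [SubChoice_isSubComNzRing of amalg_ring by <:].

End AmalgRing.

Section AmalgModule.
Variables (R1 R2 : comNzRingType) (f : {rmorphism R1 -> R2}).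
Variable J : submodClosed R2^o.
Variables (M1 : lmodType R1) (M2 : lmodType R2).
(* R1-linearity for the R1-module structure on M2 induced by f:               *)
(* phi (a *: x) = f a *: phi x.                                               *)
Variable phi : {linear M1 -> M2 | f \; *:%R}.

Definition amalg_mod_pred : {pred M1 * M2} := fun x =>
  `[< exists x1 x2, x2 \in ideal_smul J M2 /\ x = (x1, phi x1 + x2) >].

Lemma amalg_modP x :
  reflect (exists x1 x2, x2 \in ideal_smul J M2 /\ x = (x1, phi x1 + x2))
          (x \in amalg_mod_pred).
Proof. exact: asboolP. Qed.

Fact amalg_mod_closed : zmod_closed amalg_mod_pred.
Proof.
split; first by apply/amalg_modP; exists 0, 0; rewrite linear0 addr0 rpred0.
move=> _ _ /amalg_modP[x1 [x2 [Jx ->]]] /amalg_modP[y1 [y2 [Jy ->]]].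
apply/amalg_modP; exists (x1 - y1), (x2 - y2); split; first exact: rpredB.
by congr (_, _); rewrite linearB /= opprD addrACA.
Qed.

HB.instance Definition _ :=
  GRing.isZmodClosed.Build (M1 * M2)%type amalg_mod_pred amalg_mod_closed.

Record amalg_mod :=
  AmalgMod { amalg_mod_val : M1 * M2; _ : amalg_mod_val \in amalg_mod_pred }.

HB.instance Definition _ := [isSub for amalg_mod_val].
HB.instance Definition _ := [Choice of amalg_mod by <:].
HB.instance Definition _ := [SubChoice_isSubZmodule of amalg_mod by <:].

Definition amalg_scale_val (r : R1 * R2) (x : M1 * M2) : M1 * M2 :=
  let u := r.1 in let j := r.2 - f u in
  let x1 := x.1 in let x2 := x.2 - phi x1 in
  (u *: x1, phi (u *: x1) + f u *: x2 + j *: phi x1 + j *: x2).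

Lemma amalg_scale_valE r x : amalg_scale_val r x = (r.1 *: x.1, r.2 *: x.2).
Proof.
rewrite /amalg_scale_val linearZ /=; congr (_, _).
by rewrite -scalerDr -addrA -scalerDr !(addrC (phi _)) subrK -scalerDl addrC subrK.
Qed.

Fact amalg_scale_subproof (r : amalg_ring f J) (x : amalg_mod) :
  amalg_scale_val (val r) (val x) \in amalg_mod_pred.
Proof.
case: r x => r /= /amalg_ringP[u [j [jJ ->]]] [x /= /amalg_modP[x1 [x2 [Jx ->]]]].
apply/amalg_modP; exists (u *: x1), (f u *: x2 + (j *: phi x1 + j *: x2)).
split; first by rewrite !rpredD ?(mem_ideal_smul _ jJ) ?rpredZ.
by rewrite /amalg_scale_val /= ![_ + _ - _]addrAC !subrr !add0r !addrA.
Qed.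

Definition amalg_scale (r : amalg_ring f J) (x : amalg_mod) : amalg_mod :=
  AmalgMod (amalg_scale_subproof r x).

Fact amalg_scaleA a b v :
  amalg_scale a (amalg_scale b v) = amalg_scale (a * b) v.
Proof. by apply: val_inj; rewrite /= !amalg_scale_valE /= !scalerA. Qed.

Fact amalg_scale1 : left_id 1 amalg_scale.
Proof.
by move=> v; apply: val_inj; rewrite /= amalg_scale_valE /= !scale1r -surjective_pairing.
Qed.

Fact amalg_scaleDr : right_distributive amalg_scale +%R.
Proof.
by move=> a v w; apply: val_inj; rewrite /= !amalg_scale_valE /= !scalerDr.
Qed.

Fact amalg_scaleDl v : {morph amalg_scale^~ v : a b / a + b}.
Proof.
by move=> a b; apply: val_inj; rewrite /= !amalg_scale_valE /= !scalerDl.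
Qed.

HB.instance Definition _ :=
  GRing.Zmodule_isLmodule.Build (amalg_ring f J) amalg_mod
    amalg_scaleA amalg_scale1 amalg_scaleDr amalg_scaleDl.

Lemma amalg_scaleE (r : amalg_ring f J) (x : amalg_mod) u j x1 x2 :
  val r = (u, f u + j) -> val x = (x1, phi x1 + x2) ->
  val (r *: x) =
    (u *: x1, phi (u *: x1) + f u *: x2 + j *: phi x1 + j *: x2).
Proof.
move=> /= rE xE; rewrite /amalg_scale_val rE xE /=.
by rewrite ![_ + _ - _]addrAC !subrr !add0r.
Qed.

Definition amalg_submod (N1 : {pred M1}) : {pred amalg_mod} := fun x =>
  `[< exists x1 x2, [/\ x1 \in N1, x2 \in ideal_smul J M2
                      & val x = (x1, phi x1 + x2)] >].

End AmalgModule.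

Arguments amalg_mod {R1 R2 f} J {M1 M2} phi.
Arguments amalg_submod {R1 R2 f} J {M1 M2} phi N1.

(* Main.v *)
(** The projections of the amalgamated ring and module onto [R1] and [M1] are
surjective, and the amalgamated submodule is the preimage of [N1]. Being
gsdf-absorbing is reflected and preserved by preimages under a surjective
semilinear map over a surjective ring homomorphism. *)

Require Import Defs.
From HB Require Import structures.
From mathcomp Require Import all_boot all_algebra.
From mathcomp Require Import boolp.

Import GRing.Theory.
Local Open Scope ring_scope.

Section Preimage.
Variables (R S : comNzRingType) (g : {rmorphism S -> R}).
Variables (L : lmodType S) (M : lmodType R) (p : {linear L -> M | g \; *:%R}).
Hypotheses (g_surj : forall a, exists r, g r = a).
Hypotheses (p_surj : forall x, exists y, p y = x).
Variables (N : {pred M}) (P : {pred L}).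
Hypothesis PE : forall y, (y \in P) = (p y \in N).

(** Closure of [P] descends to [N] by lifting scalars along [g] and vectors along [p]; closure of
    [N] ascends by semilinearity alone. A point outside [P] maps outside [N], and a point outside
    [N] lifts outside [P]. *)
Lemma proper_submod_preimage : proper_submod P <-> proper_submod N.
Proof.
split=> -[[N0 ND] [x Nx]]; split.
- split; first by rewrite -(linear0 p) -PE.
  move=> a u v; have [r <-] := g_surj a.
  have [y <-] := p_surj u; have [z <-] := p_surj v.
  by rewrite -!PE => Py Pz; rewrite -linearP -PE ND.
- by exists (p x); rewrite -PE.
- split; first by rewrite PE linear0.
  by move=> r y z; rewrite !PE linearP => Ny Nz; apply: ND.
- by have [y yx] := p_surj x; exists y; rewrite PE yx.
Qed.

Lemma gsdf_absorbing_preimage : gsdf_absorbing P <-> gsdf_absorbing N.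
Proof.
split=> -[/proper_submod_preimage Nproper absN]; split=> // u v x.
- have [r <-] := g_surj u; have [s <-] := g_surj v; have [y <-] := p_surj x.
  (* With lifts [r], [s], [y] chosen, the premise becomes [(r ^+ 2 - s ^+ 2) *: y \in P]. *)
  rewrite -!rmorphXn -!rmorphB -rmorphD -linearZ -PE => /absN[|[k [k1]]].
    by rewrite PE linearZ; left.
  by rewrite PE linearZ /= rmorphXn => Nk; right; exists k.
- rewrite PE linearZ /= rmorphB !rmorphXn => /absN[|[k [k1 Nk]]].
    by rewrite PE linearZ /= rmorphB; left.
  by right; exists k; split=> //; rewrite PE linearZ /= rmorphXn rmorphD.
Qed.

End Preimage.

Section Projections.
Variables (R1 R2 : comNzRingType) (f : {rmorphism R1 -> R2}).
Variables (J : submodClosed R2^o) (M1 : lmodType R1) (M2 : lmodType R2).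
Variable phi : {linear M1 -> M2 | f \; *:%R}.

Definition amalg_ring_fst (r : amalg_ring f J) : R1 := (val r).1.

Fact amalg_ring_fst_zmod_morphism : zmod_morphism amalg_ring_fst.
Proof. by []. Qed.

Fact amalg_ring_fst_monoid_morphism : monoid_morphism amalg_ring_fst.
Proof. by []. Qed.

HB.instance Definition _ := GRing.isZmodMorphism.Build (amalg_ring f J) R1
  amalg_ring_fst amalg_ring_fst_zmod_morphism.
HB.instance Definition _ := GRing.isMonoidMorphism.Build (amalg_ring f J) R1
  amalg_ring_fst amalg_ring_fst_monoid_morphism.

Definition amalg_mod_fst (x : amalg_mod J phi) : M1 := (val x).1.

Fact amalg_mod_fst_zmod_morphism : zmod_morphism amalg_mod_fst.
Proof. by []. Qed.

(** True by computation: the first component of [amalg_scale_val r x] is [r.1 *: x.1]. *)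
Fact amalg_mod_fst_scalable :
  scalable_for (amalg_ring_fst \; *:%R) amalg_mod_fst.
Proof. by []. Qed.

HB.instance Definition _ := GRing.isZmodMorphism.Build (amalg_mod J phi) M1
  amalg_mod_fst amalg_mod_fst_zmod_morphism.
HB.instance Definition _ := GRing.isScalable.Build (amalg_ring f J)
  (amalg_mod J phi) M1 (amalg_ring_fst \; *:%R) amalg_mod_fst
  amalg_mod_fst_scalable.

Lemma amalg_ring_fst_surj u : exists r, amalg_ring_fst r = u.
Proof.
have ur : (u, f u) \in amalg_ring_pred f J.
  (* The lift of [u] takes the [J]-part to be 0. *)
  by apply/amalg_ringP; exists u, 0; rewrite addr0 (rpred0 J).
by exists (AmalgRing ur).
Qed.

Lemma amalg_mod_fst_surj x : exists y, amalg_mod_fst y = x.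
Proof.
have xy : (x, phi x) \in amalg_mod_pred J phi.
  by apply/amalg_modP; exists x, 0; rewrite addr0 rpred0.
by exists (AmalgMod xy).
Qed.

(** The condition on the second component already holds for every element of [amalg_mod J phi], so
    only the first component matters. *)
Lemma mem_amalg_submod (N1 : {pred M1}) (y : amalg_mod J phi) :
  (y \in amalg_submod J phi N1) = (amalg_mod_fst y \in N1).
Proof.
apply/asboolP/idP => [[x1 [x2 [Nx1 _ yE]]]|Ny].
  by rewrite /amalg_mod_fst yE.
have /amalg_modP[x1 [x2 [Jx2 yE]]] := valP y.
by exists x1, x2; split=> //; rewrite /amalg_mod_fst yE in Ny.
Qed.

End Projections.

Theorem theorem4p4 (R1 R2 : comNzRingType) (f : {rmorphism R1 -> R2})
    (J : submodClosed R2^o) (M1 : lmodType R1) (M2 : lmodType R2)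
    (phi : {linear M1 -> M2 | f \; *:%R})
    (N1 : {pred M1}) (hN1 : proper_submod N1) :
  gsdf_absorbing (amalg_submod J phi N1) <-> gsdf_absorbing N1.
Proof.
(* The scaling law of [amalg_mod_fst] determines the ring map [amalg_ring_fst]. *)
apply: (@gsdf_absorbing_preimage _ _ _ _ _ (@amalg_mod_fst R1 R2 f J M1 M2 phi)).
- exact: amalg_ring_fst_surj.
- exact: amalg_mod_fst_surj.
- exact: mem_amalg_submod.
Qed.
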